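(* Let $\rho_0$ be a two-qubit state whose reduced state $\rho_B=\mathrm{Tr}_A[\rho_0]$ on Bob's side is of full rank, and let $$\rho=\frac{1}{4}\Big(\mathbb{1}\otimes\mathbb{1}+\vec{a}\cdot\vec{\sigma}\otimes \mathbb{1}+\sum_{i=x,y,z}T_{i}\,\sigma_{i}\otimes\sigma_{i}\Big)$$ be a canonical form of $\rho_0$ (as defined in the context), with $T=\mathrm{diag}(T_x,T_y,T_z)$. If $$\max_{\hat{x}\in\mathbb{R}^3,\ \|\hat x\|=1} \Big[(\vec{a}\cdot\hat{x})^2+2\,\|T\hat{x}\|\Big] \leq 1,$$ where $\|\cdot\|$ is the Euclidean norm, then $\rho$ is unsteerable from Alice to Bob for arbitrary projective measurements.
   Context: Notation: $\vec\sigma=(\sigma_x,\sigma_y,\sigma_z)$ are the Pauli matrices. Canonical form: given a two-qubit state $\rho_0$ with $\rho_B=\mathrm{Tr}_A\rho_0$ invertible, first form $\rho_1=(\mathbb{1}\otimes\rho_B^{-1/2})\rho_0(\mathbb{1}\otimes\rho_B^{-1/2})/\mathrm{Tr}[(\mathbb{1}\otimes\rho_B^{-1/2})\rho_0(\mathbb{1}\otimes\rho_B^{-1/2})]$, a two-qubit state whose Bob marginal is $\mathbb{1}/2$; then apply local unitaries $U_A\otimes U_B$ so that, in the expansion $\frac14(\mathbb{1}\otimes\mathbb{1}+\vec a\cdot\vec\sigma\otimes\mathbb{1}+\vec b\cdot\vec\sigma\,\otimes... )$ in the local Pauli basis, Bob's local Bloch vector is $0$ and the correlation matrix $T_{ij}=\mathrm{Tr}[\rho\,\sigma_i\otimes\sigma_j]$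 is diagonal; the resulting state $\rho$ has the displayed form. Steering: for a bipartite state $\rho$ and measurements on Alice's side given by POVMs $\{M_{a|x}\}_a$, the assemblage is $\sigma_{a|x}=\mathrm{Tr}_A[(M_{a|x}\otimes\mathbb{1})\rho]$. The state $\rho$ is unsteerable from Alice to Bob for projective measurements if there exist a family of positive semidefinite operators $\{\sigma_\lambda\}$ on Bob's qubit with $\int\mathrm{Tr}\,\sigma_\lambda\,d\lambda=1$ and, for every projective measurement $x$ of Alice (i.e. $M_{\pm|\hat x}=(\mathbb{1}\pm\hat x\cdot\vec\sigma)/2$ for any unit vector $\hat x$, together with trivial measurements) and outcome $a$, response probabilities $p(a|x,\lambda)\ge0$ with $\sum_a p(a|x,\lambda)=1$, such that $\sigma_{a|x}=\int \sigma_\lambda\,p(a|x,\lambda)\,d\lambda$ for all $a,x$ (a single local hidden state model for all projective measurements simultaneously). *)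

(* Defs.v *)
From HB Require Import structures.
From mathcomp Require Import all_boot all_order all_algebra.
From mathcomp Require Import complex.
From mathcomp Require Import boolp classical_sets reals ereal measure lebesgue_measure lebesgue_integral.

Set Implicit Arguments.
Unset Strict Implicit.
Unset Printing Implicit Defensive.

Import Order.TTheory GRing.Theory Num.Theory.
Local Open Scope ring_scope.

Section QubitDefs.
Variable R : realType.
Local Notation C := (complex R).

Definition cconj (z : C) : C := Complex (complex.Re z) (- complex.Im z).
Definition rC (r : R) : C := Complex r 0.
Definition iC : C := Complex 0 1.

Definition adjmx (m n : nat) (A : 'M[C]_(m, n)) : 'M[C]_(n, m) :=
  \matrix_(i, j) cconj (A j i).

Definition hermitian (n : nat) (A : 'M[C]_n) : Prop := adjmx A = A.

Definition psd (n : nat) (A : 'M[C]_n) : Prop :=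
  hermitian A /\ forall v : 'cV[C]_n, 0 <= complex.Re ((adjmx v *m A *m v) 0 0).
Definition posdef (n : nat) (A : 'M[C]_n) : Prop :=
  hermitian A /\ forall v : 'cV[C]_n, v != 0 -> 0 < complex.Re ((adjmx v *m A *m v) 0 0).

Definition unitary (n : nat) (U : 'M[C]_n) : Prop := U *m adjmx U = 1%:M.

Definition is_state (n : nat) (rho : 'M[C]_n) : Prop := psd rho /\ \tr rho = 1.

(* two-qubit indexing: basis |i>_A |j>_B  <->  index 2*i + j of 'I_4 *)
Definition idx2 (i j : 'I_2) : 'I_4 := inord (2 * i + j).
Definition hiA (k : 'I_4) : 'I_2 := inord (k %/ 2).
Definition loB (k : 'I_4) : 'I_2 := inord (k %% 2).

Definition kron (A B : 'M[C]_2) : 'M[C]_4 :=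
  \matrix_(k, l) (A (hiA k) (hiA l) * B (loB k) (loB l)).

Definition ptrA (M : 'M[C]_4) : 'M[C]_2 :=
  \matrix_(j, j') \sum_(i < 2) M (idx2 i j) (idx2 i j').

Definition pauli (k : 'I_3) : 'M[C]_2 :=
  \matrix_(i, j)
    (if val k == 0%N then (if i == j then 0 else 1)
     else if val k == 1%N then
       (if i == j then 0 else if val i == 0%N then - iC else iC)
     else (if i == j then (if val i == 0%N then 1 else -1) else 0)).

Definition bloch (v : 'I_3 -> R) : 'M[C]_2 := \sum_(k < 3) rC (v k) *: pauli k.

Definition dot3 (u v : 'I_3 -> R) : R := \sum_(k < 3) u k * v k.
Definition unit3 (x : 'I_3 -> R) : Prop := \sum_(k < 3) x k ^+ 2 = 1.

Definition canon_state (a T : 'I_3 -> R) : 'M[C]_4 :=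
  rC (4%:R^-1) *: (kron 1%:M 1%:M + kron (bloch a) 1%:M
                   + \sum_(k < 3) rC (T k) *: kron (pauli k) (pauli k)).

(* rho is a canonical form of rho0: filter Bob with rho_B^{-1/2} (the unique
   positive definite square root of rho_B^{-1}), normalise, then apply local
   unitaries. *)
Definition canonical_form_of (rho0 rho : 'M[C]_4) : Prop :=
  exists S : 'M[C]_2,
    posdef S /\ S *m S = invmx (ptrA rho0) /\
    let F := kron 1%:M S *m rho0 *m kron 1%:M S in
    let rho1 := (\tr F)^-1 *: F in
    exists UA UB : 'M[C]_2, unitary UA /\ unitary UB /\
      rho = kron UA UB *m rho1 *m adjmx (kron UA UB).

Definition projM (x : 'I_3 -> R) (o : bool) : 'M[C]_2 :=
  rC (2%:R^-1) *: (1%:M + (if o then 1 else -1) *: bloch x).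

Definition assemblage (rho : 'M[C]_4) (x : 'I_3 -> R) (o : bool) : 'M[C]_2 :=
  ptrA (kron (projM x o) 1%:M *m rho).

Local Open Scope ereal_scope.

(* Local hidden state model for all projective measurements (plus the trivial
   measurement), hidden variable lambda ranging over a measure space (L, mu). *)
Definition unsteerable_AB_proj (rho : 'M[C]_4) : Prop :=
  exists (d : measure_display) (L : measurableType d)
         (mu : {measure set L -> \bar R})
         (sig : L -> 'M[C]_2) (p : ('I_3 -> R) -> bool -> L -> R),
    (forall l, psd (sig l)) /\
    (forall i j, mu.-integrable setT (fun l => (complex.Re (sig l i j))%:E) /\
                 mu.-integrable setT (fun l => (complex.Im (sig l i j))%:E)) /\
    \int[mu]_l (complex.Re (\tr (sig l)))%:E = 1 /\
    (forall x, unit3 x -> forall o l, (0 <= p x o l)%R) /\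
    (forall x, unit3 x -> forall l, (p x true l + p x false l = 1)%R) /\
    (forall x, unit3 x -> forall o, measurable_fun setT (p x o)) /\
    (forall x, unit3 x -> forall o (i j : 'I_2),
        (complex.Re (assemblage rho x o i j))%:E = \int[mu]_l (p x o l * complex.Re (sig l i j))%:E /\
        (complex.Im (assemblage rho x o i j))%:E = \int[mu]_l (p x o l * complex.Im (sig l i j))%:E) /\
    (* trivial measurement {1}: sigma = rho_B = int sigma_lambda *)
    (forall i j : 'I_2,
        (complex.Re (ptrA rho i j))%:E = \int[mu]_l (complex.Re (sig l i j))%:E /\
        (complex.Im (ptrA rho i j))%:E = \int[mu]_l (complex.Im (sig l i j))%:E).

End QubitDefs.

(* Main.v *)
Require Import Defs.
From HB Require Import structures.
From mathcomp Require Import all_boot all_order all_algebra.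
From mathcomp Require Import complex.
From mathcomp Require Import boolp classical_sets reals ereal measure lebesgue_measure lebesgue_integral.
From mathcomp Require Import ring lra functions.
From mathcomp Require Import normedtype measurable_realfun ftc realfun derive.
Import Order.TTheory GRing.Theory Num.Theory.
Import numFieldNormedType.Exports.
Local Open Scope classical_set_scope.
Local Open Scope ring_scope.

Set Implicit Arguments.
Unset Strict Implicit.
Unset Printing Implicit Defensive.

(** The hidden variable [l] is a point of the unit ball of R^3 with Lebesgue
    measure, and the hidden state is [(|l| 1 + l . sigma) / 2] up to
    normalisation, i.e. a pure state with uniformly distributed Bloch vector
    [l / |l|].  For a unit vector [t] and [-1 <= c <= 1], answering "+" exactly
    on the cap [l . t >= c |l|] steers Bob to a state of weight [(1 - c) / 2]
    and unnormalised Bloch vector [(1 - c^2) / 4 * t].  Alice's measurement [x]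
    requires weight [(1 + a.x) / 2] and Bloch vector [T x / 2], so one takes
    [c = - a.x] and [t] parallel to [T x]; the hypothesis on [x] says precisely
    that the cap gives a long enough vector, which is then shortened by mixing
    the cap with the constant answer of the same weight.

    The cap moments are computed for vertical [t], where
    [(z, |l|^2)] has a constant density on [z^2 <= |l|^2], and are transported
    to arbitrary [t] by rotation invariance of Lebesgue measure: a planar
    rotation is a product of three shears, each of which acts by translations
    on the lines of a Fubini decomposition. *)

(** * Rotation invariance of Lebesgue measure on R^3 *)

Section MeasurePreserving.
Context {R : realType}.

(** Source and target measures are independent parameters, so that regroupings and permutations of
    coordinates are treated like self-maps. *)
Definition mpres {d d'} {T : measurableType d} {T' : measurableType d'}
    (m : {measure set T -> \bar R}) (m' : {measure set T' -> \bar R}) (g : T -> T') :=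
  measurable_fun setT g /\ forall A, measurable A -> m (g @^-1` A) = m' A.

Lemma mpres_comp {d d' d''} {T : measurableType d} {T' : measurableType d'}
    {T'' : measurableType d''} (m : {measure set T -> \bar R})
    (m' : {measure set T' -> \bar R}) (m'' : {measure set T'' -> \bar R}) g h :
  mpres m m' g -> mpres m' m'' h -> mpres m m'' (h \o g).
Proof.
move=> [mg mpg] [mh mph]; split; first exact: measurableT_comp.
move=> A mA; rewrite comp_preimage mpg ?mph//.
by rewrite -[X in measurable X]setTI; exact: mh.
Qed.

Lemma mpres_id {d} {T : measurableType d} (m : {measure set T -> \bar R}) :
  mpres m m idfun.
Proof. by split=> //; exact: measurable_id. Qed.

Lemma mpres_ge0_integral {d d'} {T : measurableType d} {T' : measurableType d'}
    (m : {measure set T -> \bar R}) (m' : {measure set T' -> \bar R}) g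
    (f : T' -> \bar R) :
  mpres m m' g -> measurable_fun setT f -> (forall y, 0 <= f y)%E ->
  (\int[m']_y f y = \int[m]_x f (g x))%E.
Proof.
move=> [mg mpg] mf f0.
rewrite -[RHS](@ge0_integral_pushforward _ _ _ _ _ _ mg m setT f)//.
by apply: eq_measure_integral => A mA _; rewrite /pushforward -mpg.
Qed.

Lemma mpres_integrable {d d'} {T : measurableType d} {T' : measurableType d'}
    (m : {measure set T -> \bar R}) (m' : {measure set T' -> \bar R}) g
    (f : T' -> R) :
  mpres m m' g -> m'.-integrable setT (EFin \o f) ->
  m.-integrable setT (EFin \o (f \o g)).
Proof.
move=> [mg mpg] /integrableP[mf fi].
apply/integrableP; split; first exact: (measurableT_comp mf mg).
rewrite -(mpres_ge0_integral (f := fun y => `|(EFin \o f) y|%E) (conj mg mpg))//.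
exact: measurableT_comp.
Qed.

Lemma mpres_Rintegral {d d'} {T : measurableType d} {T' : measurableType d'}
    (m : {measure set T -> \bar R}) (m' : {measure set T' -> \bar R}) g
    (f : T' -> R) :
  mpres m m' g -> m'.-integrable setT (EFin \o f) ->
  \int[m']_y f y = \int[m]_x f (g x).
Proof.
move=> mpg fi; rewrite /Rintegral; congr fine.
have fgi := mpres_integrable mpg fi.
case: mpg => mg mpg.
rewrite -[RHS](@integral_pushforward _ _ _ _ _ _ mg m setT (EFin \o f))//.
  by apply: eq_measure_integral => A mA _; rewrite /pushforward -mpg.
by case/integrableP: fi.
Qed.

End MeasurePreserving.

Section SigmaFiniteProduct.
Context {R : realType} {d d'} {T : measurableType d} {T' : measurableType d'}.
Context (m : {sigma_finite_measure set T -> \bar R})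
          (m' : {sigma_finite_measure set T' -> \bar R}).

(* A fresh head symbol for [m \x m'], on which the sigma-finite structure can
   be inferred: on [\x] itself the canonical sigma-finite instance requires
   subprobability measures. *)
Definition sprod : set (T * T') -> \bar R := (m \x m')%E.

HB.instance Definition _ := Measure.copy sprod (m \x m')%E.

Lemma sprod_sigma_finite : sigma_finite setT sprod.
Proof.
have /sigma_finiteP[F [TF ndF Foo]] := sigma_finiteT m.
have /sigma_finiteP[G [TG ndG Goo]] := sigma_finiteT m'.
exists (fun n => F n `*` G n).
  apply/seteqP; split => // -[x y] _.
  have [i _ Fx] : (\bigcup_i F i) x by rewrite -TF.
  have [j _ Gy] : (\bigcup_i G i) y by rewrite -TG.
  (* Both exhausting sequences increase, so the larger index serves for both coordinates. *)
  exists (maxn i j) => //; split.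
  - by move: Fx; exact/subsetPset/ndF/leq_maxl.
  - by move: Gy; exact/subsetPset/ndG/leq_maxr.
move=> k; have [mF Fk] := Foo k; have [mG Gk] := Goo k.
split; first exact: measurableX.
by rewrite /sprod product_measure1E// lte_mul_pinfty// ge0_fin_numE.
Qed.

HB.instance Definition _ :=
  Measure_isSigmaFinite.Build _ _ _ sprod sprod_sigma_finite.

End SigmaFiniteProduct.

(** * Measure-preserving maps between product spaces *)

Section Products.
Context {R : realType}.
Local Open Scope ereal_scope.

(** The pushforward under the swap agrees with the product measure on rectangles, which determine
    it. *)
Lemma mpres_swap {d d'} {T : measurableType d} {T' : measurableType d'}
    (m : {sigma_finite_measure set T -> \bar R})
    (m' : {sigma_finite_measure set T' -> \bar R}) :
  mpres (sprod m m') (sprod m' m) (fun l => (l.2, l.1)).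
Proof.
have ms : measurable_fun setT (fun l : T * T' => (l.2, l.1)) by exact: measurable_swap.
split => // A mA; apply/esym.
pose mm : {measure set (T' * T) -> \bar R} :=
  pushforward (sprod m m') (fun l : T * T' => (l.2, l.1)).
transitivity (mm ms A) => //.
apply: product_measure_unique => // B C mB mC.
transitivity ((sprod m m') (C `*` B)).
  by congr ((sprod m m') _); apply/seteqP; split => -[x y] /= [].
by rewrite /sprod product_measure1E// muleC.
Qed.

(** Cavalieri's principle: the section at [x] of the preimage is the preimage under [h x] of the
    section at [x], so the integrands agree pointwise. *)
Lemma mpres_fiber {d d' d''} {T : measurableType d} {T' : measurableType d'}
    {T'' : measurableType d''}
    (m : {sigma_finite_measure set T -> \bar R})
    (m' : {sigma_finite_measure set T' -> \bar R})
    (m'' : {sigma_finite_measure set T'' -> \bar R}) (h : T -> T' -> T'') :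
  measurable_fun setT (fun l : T * T' => h l.1 l.2) ->
  (forall x, mpres m' m'' (h x)) ->
  mpres (sprod m m') (sprod m m'') (fun l => (l.1, h l.1 l.2)).
Proof.
move=> mh mph; split; first exact: measurable_fun_pair.
move=> A mA; apply: eq_integral => x _ /=.
have [_ <-] := mph x; last exact: measurable_xsection.
by congr (m' _); apply/seteqP; split => y; rewrite /xsection/= !inE.
Qed.

Lemma mpres_prodl {d d'} {T : measurableType d} {T' : measurableType d'}
    (m : {sigma_finite_measure set T -> \bar R})
    (m' : {sigma_finite_measure set T' -> \bar R}) (g : T -> T) :
  mpres m m g -> mpres (sprod m m') (sprod m m') (fun l => (g l.1, l.2)).
Proof.
move=> mg.
have := mpres_comp (mpres_swap m m')
  (mpres_comp (mpres_fiber m' (h := fun _ => g) _ (fun=> mg)) (mpres_swap m' m)).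
by apply; case: mg => mg _; exact: measurableT_comp.
Qed.

(** By Tonelli, both sides are the same iterated integral of the [m'']-measures of the sections of
    the set. This makes cyclic permutations of the three coordinates available. *)
Lemma mpres_assoc {d d' d''} {T : measurableType d} {T' : measurableType d'}
    {T'' : measurableType d''}
    (m : {sigma_finite_measure set T -> \bar R})
    (m' : {sigma_finite_measure set T' -> \bar R})
    (m'' : {sigma_finite_measure set T'' -> \bar R}) :
  mpres (sprod (sprod m m') m'') (sprod m (sprod m' m'')) (fun l => (l.1.1, (l.1.2, l.2))).
Proof.
have mf : measurable_fun setT
    (fun l : T * T' * T'' => (l.1.1, (l.1.2, l.2))).
  apply: measurable_fun_pair; first by apply: measurableT_comp.
  by apply: measurable_fun_pair => //; apply: measurableT_comp.
split => // A mA.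
transitivity (\int[m \x m']_l m'' (xsection
    ((fun l : T * T' * T'' => (l.1.1, (l.1.2, l.2))) @^-1` A) l)); first by [].
rewrite fubini_tonelli1; [|  |by move=> ?; exact: measure_ge0]; last first.
  by apply: measurable_fun_xsection; rewrite -[X in measurable X]setTI; exact: mf.
transitivity (\int[m]_x (m' \x m'') (xsection A x)); last by [].
apply: eq_integral => x _; apply: eq_integral => y _ /=.
by congr (m'' _); apply/seteqP; split => z; rewrite /xsection/= !inE/= inE.
Qed.

End Products.

(** * Affine maps, shears and rotations under Lebesgue measure *)

Section Lebesgue.
Context {R : realType}.
Local Notation mR := (measurableTypeR R).
Local Notation leb := (@lebesgue_measure R).

(** The right-hand side is a measure in [A] that gives half-open intervals their length, hence is
    Lebesgue measure. *)
Lemma lebesgue_measure_affine (k t : R) (A : set mR) : 0 < k -> measurable A ->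
  (leb A = k%:E * leb ((fun x : mR => k * x + t : mR)%R @^-1` A))%E.
Proof.
move=> k0 mA.
have mf : measurable_fun setT (fun x : mR => k * x + t : mR).
  by apply: measurable_funD => //; apply: measurable_funM.
pose mm : {measure set mR -> \bar R} :=
  mscale (NngNum (ltW k0)) (pushforward leb (fun x : mR => k * x + t : mR)).
transitivity (mm mf A) => //.
apply: lebesgue_measure_unique => // X [[a b] _ <-] /=.
rewrite /mscale/=.
pose I : set mR := `](a - t) / k, (b - t) / k]%classic.
transitivity (k%:E * leb I)%E; last first.
  congr (_ * leb _)%E; apply/seteqP; split => x /=;
    rewrite /I /= !in_itv/= ltr_pdivrMr// ler_pdivlMr//; lra.
rewrite /I !lebesgue_measure_itv/= !lte_fin ltr_pM2r ?invr_gt0// ltrD2r.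
case: ifPn => _; last by rewrite mule0.
rewrite -!EFinD -EFinM; congr EFin; field; lra.
Qed.

Lemma mpres_shift (t : R) : mpres leb leb (fun x : mR => x + t : mR).
Proof.
split=> [|A mA].
  by apply: measurable_funD.
rewrite [RHS](lebesgue_measure_affine t ltr01)// mul1e; congr (leb _).
by apply/seteqP; split => x; rewrite /= mul1r.
Qed.

Notation leb2 := (sprod leb leb).

Lemma mpres_sheary (t : R) : mpres leb2 leb2 (fun l : mR * mR => (l.1, l.2 + t * l.1) : mR * mR).
Proof.
apply: (@mpres_fiber _ _ _ _ _ _ _ leb leb leb (fun x y => y + t * x)); last first.
  by move=> x; exact: mpres_shift.
by apply: measurable_funD => //; apply: measurable_funM.
Qed.

Lemma mpres_shearx (t : R) : mpres leb2 leb2 (fun l : mR * mR => (l.1 + t * l.2, l.2) : mR * mR).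
Proof.
exact: (mpres_comp (mpres_swap leb leb)
         (mpres_comp (mpres_sheary t) (mpres_swap leb leb))).
Qed.

(* [c] and [s] are the cosine and the sine of the angle. *)
Definition rot2 (c s : R) (l : mR * mR) : mR * mR :=
  (c * l.1 - s * l.2, s * l.1 + c * l.2).

Lemma mpres_rot2 (c s : R) : c ^+ 2 + s ^+ 2 = 1 -> mpres leb2 leb2 (rot2 c s).
Proof.
have rot_sin_neq0 c' s' : s' != 0 -> c' ^+ 2 + s' ^+ 2 = 1 ->
    mpres leb2 leb2 (rot2 c' s').
  (* With angle theta, [a] is -tan(theta/2): the rotation is a horizontal shear by [a], a vertical
     one by sin(theta), and the horizontal one again. *)
  move=> s0 cs1; pose a := (c' - 1) / s'.
  have -> : rot2 c' s' = (fun l => (l.1 + a * l.2, l.2)) \o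
      (fun l => (l.1, l.2 + s' * l.1)) \o (fun l => (l.1 + a * l.2, l.2)).
    have sa : s' * a = c' - 1 by rewrite /a; field.
    have sa' : (c' + 1) * a = - s'.
      by apply: (mulfI s0); rewrite mulrCA sa; nra.
    apply/funext => -[x y]; rewrite /rot2/=; congr pair.
      transitivity ((1 + s' * a) * x + (2 + s' * a) * a * y); last by ring.
      rewrite sa (_ : 2 + (c' - 1) = c' + 1); last by ring.
      by rewrite sa'; ring.
    transitivity ((1 + s' * a) * y + s' * x); last by ring.
    by rewrite sa; ring.
  exact: mpres_comp (mpres_comp (mpres_shearx a) (mpres_sheary s')) (mpres_shearx a).
move=> cs1; have [s0|s0] := eqVneq s 0; last exact: rot_sin_neq0.
move: cs1; rewrite s0 expr0n addr0 => /eqP; rewrite sqrf_eq1 => /orP[]/eqP ->.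
  have -> : rot2 1 0 = idfun by apply/funext => -[x y]; rewrite /rot2/= !mul1r !mul0r subr0 add0r.
  exact: mpres_id.
(* The half-turn has zero sine, so the shear formula fails for it; it is the square of a
   quarter-turn. *)
have -> : rot2 (-1) 0 = rot2 0 1 \o rot2 0 1.
  by apply/funext => -[x y]; rewrite /rot2/=; congr pair; ring.
have rot90 : mpres leb2 leb2 (rot2 0 1).
  by apply: rot_sin_neq0; rewrite ?oner_neq0//; lra.
exact: (mpres_comp rot90 rot90).
Qed.

Notation leb3 := (sprod leb2 leb).

Definition rotxy (c s : R) (l : mR * mR * mR) : mR * mR * mR := (rot2 c s l.1, l.2).

Lemma mpres_rotxy c s : c ^+ 2 + s ^+ 2 = 1 -> mpres leb3 leb3 (rotxy c s).
Proof. by move=> cs1; apply: mpres_prodl; exact: mpres_rot2. Qed.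

Definition rotyz (c s : R) (l : mR * mR * mR) : mR * mR * mR :=
  (l.1.1, c * l.1.2 - s * l.2, s * l.1.2 + c * l.2).

(** Conjugate of [rotxy] by the cyclic permutation [mcyc] of the coordinates, whose inverse is its
    square. *)
Lemma mpres_rotyz c s : c ^+ 2 + s ^+ 2 = 1 -> mpres leb3 leb3 (rotyz c s).
Proof.
move=> cs1.
have mcyc : mpres leb3 leb3 (fun l => (l.1.2, l.2, l.1.1)).
  exact: (mpres_comp (mpres_assoc leb leb leb) (mpres_swap leb leb2)).
exact: (mpres_comp mcyc (mpres_comp (mpres_rotxy cs1) (mpres_comp mcyc mcyc))).
Qed.

End Lebesgue.

(** * The radial density *)

Section Radial.
Context {R : realType}.
Local Notation mR := (measurableTypeR R).
Local Notation leb := (@lebesgue_measure R).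
Local Notation leb2 := (sprod leb leb).
Local Notation leb3 := (sprod leb2 leb).

Definition scale2 (k : R) (l : mR * mR) : mR * mR := (k * l.1, k * l.2).

Lemma leb2_scale (k : R) (A : set (mR * mR)) : 0 < k -> measurable A ->
  (leb2 A = (k * k)%:E * leb2 ((scale2 k) @^-1` A))%E.
Proof.
move=> k0 mA.
have mf : measurable_fun setT (scale2 k).
  by apply: measurable_fun_pair; apply: measurable_funM.
have kk0 : 0 <= k * k by rewrite mulr_ge0// ltW.
pose mm : {measure set (mR * mR)%type -> \bar R} :=
  mscale (NngNum kk0) (pushforward leb2 (scale2 k)).
transitivity (mm mf A); last by [].
apply: product_measure_unique => // B C mB mC.
rewrite /mm /mscale/=.
transitivity ((k * k)%:E * (leb \x leb)%E
  (((fun x : mR => k * x + 0 : mR)%R @^-1` B) `*` ((fun x : mR => k * x + 0 : mR)%R @^-1` C)))%E.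
  congr (_ * (leb \x leb) _)%E.
  by apply/seteqP; split => -[x y] /=; rewrite /= !addr0.
have mk X : measurable X -> measurable ((fun x : mR => k * x + 0 : mR) @^-1` X).
  move=> mX; rewrite -[X in measurable X]setTI.
  have : measurable_fun setT (fun x : mR => k * x + 0 : mR).
    by apply: measurable_funD => //; apply: measurable_funM.
  exact.
rewrite product_measure1E; [|exact: mk|exact: mk].
rewrite (lebesgue_measure_affine 0 k0 mB) (lebesgue_measure_affine 0 k0 mC).
by rewrite EFinM muleACA.
Qed.

(** The squared radius is used because the area of a disc is linear in it, so its law has constant
    density; accordingly [disc s] has radius sqrt(s). *)
Definition nsq2 (l : mR * mR) : mR := l.1 ^+ 2 + l.2 ^+ 2.

Lemma measurable_nsq2 : measurable_fun setT nsq2.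
Proof. by apply: measurable_funD; apply: measurable_funX. Qed.

Definition disc (s : R) : set (mR * mR) := [set l | nsq2 l <= s].

Lemma measurable_disc s : measurable (disc s).
Proof.
rewrite -[X in measurable X]setTI (_ : disc s = nsq2 @^-1` `]-oo, s]%classic).
  exact: measurable_nsq2.
by apply/seteqP; split => l; rewrite /disc/= in_itv.
Qed.

(** This is pi, kept abstract: it cancels against the normalisation in [ball_weight]. *)
Definition disc_const : R := fine (leb2 (disc 1)).

Lemma disc_constE : leb2 (disc 1) = disc_const%:E.
Proof.
rewrite /disc_const fineK// ge0_fin_numE//.
apply: (@le_lt_trans _ _ ((leb \x leb)%E (`[-1, 1]%classic `*` `[-1, 1]%classic))).
  apply: le_measure; rewrite ?inE; [exact: measurable_disc|exact: measurableX|].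
  move=> [x y]; rewrite /disc/nsq2/= !in_itv/= => h.
  by split; apply/andP; split; nra.
rewrite product_measure1E//= !lebesgue_measure_itv/= lte_fin ifT; last lra.
by rewrite -EFinD -EFinM ltry.
Qed.

Lemma disc_const_gt0 : 0 < disc_const.
Proof.
rewrite -lte_fin -disc_constE.
apply: (@lt_le_trans _ _ ((leb \x leb)%E (`[0, 1/2]%classic `*` `[0, 1/2]%classic))).
  rewrite product_measure1E//= !lebesgue_measure_itv/= lte_fin ifT; last lra.
  by rewrite -EFinD -EFinM lte_fin; lra.
apply: le_measure; rewrite ?inE; [exact: measurableX|exact: measurable_disc|].
move=> [x y]; rewrite /disc/nsq2/= !in_itv/= => -[/andP[? ?] /andP[? ?]]; nra.
Qed.

(** A disc with [s > 0] is the unit disc scaled by sqrt(s); for [s = 0] it is a point inside a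
    product of null sets, and for [s < 0] it is empty. *)
Lemma leb2_disc s : leb2 (disc s) = (disc_const * Num.max s 0)%:E.
Proof.
have [s0|s0|->] := ltgtP s 0.
- rewrite mulr0 (_ : disc s = set0) ?measure0//.
  apply/seteqP; split => // -[x y]; rewrite /disc/nsq2/= => h.
  by have := sqr_ge0 x; have := sqr_ge0 y; lra.
- have r0 : 0 < Num.sqrt s by rewrite sqrtr_gt0.
  have ss : Num.sqrt s ^+ 2 = s by rewrite sqr_sqrtr// ltW.
  rewrite (leb2_scale r0 (measurable_disc s)) -expr2 ss mulrC EFinM -disc_constE.
  congr (_ * leb2 _)%E; apply/seteqP.
  by split => -[x y]; rewrite /disc/nsq2/= !exprMn ss -mulrDr ger_pMr.
- rewrite mulr0; apply/eqP; rewrite eq_le measure_ge0 andbT.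
  pose Z : set mR := [set 0].
  apply: (@le_trans _ _ ((leb \x leb)%E (Z `*` Z))); last first.
    have Z0 : leb Z = 0%E by exact: lebesgue_measure_set1.
    by rewrite product_measure1E//= ?Z0 ?mule0//; exact: measurable_set1.
  apply: le_measure; rewrite ?inE;
    [exact: measurable_disc|by apply: measurableX; exact: measurable_set1|].
  move=> [x y]; rewrite /disc/nsq2/= => h.
  by have := sqr_ge0 x; have := sqr_ge0 y => y2 x2; split;
    apply/eqP; rewrite -sqrf_eq0; apply/eqP; lra.
Qed.

Lemma leb2_annulus a b : a <= b ->
  leb2 (nsq2 @^-1` `]a, b]) = (disc_const * (Num.max b 0 - Num.max a 0))%:E.
Proof.
move=> ab.
have -> : nsq2 @^-1` `]a, b] = disc b `\` disc a.
  apply/seteqP; split => l; rewrite /disc/= in_itv/=.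
    by move=> /andP[? ?]; split=> //; apply/negP; rewrite -ltNge.
  by move=> [-> /negP]; rewrite -ltNge andbT.
have mD := measurable_disc.
rewrite measureD; [|exact: mD|exact: mD|]; last first.
  by apply: (@le_lt_trans _ _ (disc_const * Num.max b 0)%:E); rewrite ?ltry// -leb2_disc.
rewrite setIidr; last by move=> l; rewrite /disc/= => /le_trans; exact.
by rewrite /= !leb2_disc mulrBr EFinB.
Qed.

(** The normalised law of [nsq2] lives on the nonnegative half-line. Adding Lebesgue measure on the
    negative half-line gives a measure on all of R that agrees with Lebesgue measure on half-open
    intervals, so the two coincide. *)
Lemma leb2_nsq2 (A : set mR) : measurable A ->
  leb2 (nsq2 @^-1` A) = (disc_const%:E * leb (A `&` `[0%R, +oo[))%E.
Proof.
move=> mA; have D0 := disc_const_gt0.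
have Di0 : 0 <= disc_const^-1 by rewrite invr_ge0 ltW.
pose neg : set mR := `]-oo, 0[%classic.
have mneg : measurable neg by exact: measurable_itv.
pose m1 : {measure set mR -> \bar R} :=
  mscale (NngNum Di0) (pushforward leb2 nsq2).
pose m2 : {measure set mR -> \bar R} := mrestr leb mneg.
have {m1 m2} lebE B : measurable B ->
    leb B = ((disc_const^-1)%:E * leb2 (nsq2 @^-1` B) + leb (B `&` neg))%E.
  move=> mB; transitivity (measure_add (m1 measurable_nsq2) m2 B); last first.
    by rewrite measure_addE.
  apply: lebesgue_measure_unique => // X [[a b] _ <-] /=.
  rewrite [RHS](measure_addE (m1 measurable_nsq2) m2) /m1 /m2 /= /mscale /mrestr /=.
  have [ab|ba] := leP a b; last first.
    rewrite (_ : `]a, b]%classic = set0); last first.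
      by apply/seteqP; split => // x; rewrite /= in_itv/=; lra.
    by rewrite /pushforward preimage_set0 set0I !measure0 mule0 adde0.
  rewrite /pushforward leb2_annulus// -EFinM mulKf ?gt_eqF//.
  have [b0|b0] := ltP b 0.
    rewrite setIidl; last by move=> x; rewrite /neg /= !in_itv/=; lra.
    by rewrite (max_r (ltW (le_lt_trans ab b0))) subrr add0e.
  have [a0|a0] := leP 0 a.
    rewrite (_ : _ `&` neg = set0) ?measure0; last first.
      by apply/seteqP; split => // x; rewrite /neg /= !in_itv/=; lra.
    rewrite lebesgue_measure_itv/= lte_fin adde0.
    move: ab.
    by rewrite le_eqVlt => /orP[/eqP ->|->//]; rewrite ltxx subrr.
  rewrite (_ : _ `&` neg = `]a, 0[%classic); last first.
    by apply/seteqP; split => // x; rewrite /neg /= !in_itv/=; lra.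
  rewrite !lebesgue_measure_itv/= !lte_fin a0 (lt_le_trans a0 b0).
  rewrite -!EFinD.
  by congr EFin; lra.
(* On this set the added negative part vanishes, and intersecting leaves the preimage unchanged
   since [nsq2] is nonnegative. *)
have mApos : measurable (A `&` `[0, +oo[) by exact: measurableI.
rewrite lebE// (_ : _ `&` neg = set0) ?measure0; last first.
  by apply/seteqP; split => // x; rewrite /neg /= !in_itv/=; lra.
rewrite adde0 muleA -EFinM divff ?gt_eqF// mul1e; congr (leb2 _).
apply/seteqP; split => l /=; last by case.
by move=> Al; split => //; rewrite in_itv/= andbT addr_ge0// sqr_ge0.
Qed.

Lemma ge0_integral_nsq2 (f : mR -> \bar R) :
  measurable_fun setT f -> (forall x, 0 <= f x)%E ->
  (\int[leb2]_l f (nsq2 l) = disc_const%:E * \int[leb]_(x in `[0%R, +oo[) f x)%E.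
Proof.
move=> mf f0; have D0 := ltW disc_const_gt0.
have mpos : measurable (`[0, +oo[%classic : set mR) by exact: measurable_itv.
have ph : nsq2 @^-1` `[0, +oo[ = setT.
  by apply/seteqP; split => // l _; rewrite /= in_itv/= andbT addr_ge0// sqr_ge0.
have mfp : measurable_fun (`[0, +oo[%classic : set mR) f by exact: measurable_funTS.
rewrite -[in LHS]ph.
rewrite -(@ge0_integral_pushforward _ _ _ _ _ _ measurable_nsq2 leb2 `[0, +oo[ f)//.
rewrite -(ge0_integral_mscale leb mpos (NngNum D0))//.
apply: eq_measure_integral => [|mnsq A mA Ap]; first exact: measurable_nsq2.
rewrite /= /mscale /= /pushforward leb2_nsq2// setIidl//.
Qed.

Definition nsq3 (l : mR * mR * mR) : mR := nsq2 l.1 + l.2 ^+ 2.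

(** At fixed height [z], the horizontal plane is integrated through [q = nsq2], then [n = q + z^2]
    is substituted and the order exchanged by Tonelli. The vanishing of [h] for [n < z^2] absorbs
    the constraint [q >= 0]. *)
Lemma ge0_integral_nsq3 (h : mR * mR -> \bar R) :
  measurable_fun setT h -> (forall l, 0 <= h l)%E ->
  (forall z n, n < z ^+ 2 -> h (z, n) = 0%E) ->
  (\int[leb3]_l h (l.2, nsq3 l) =
   disc_const%:E * \int[leb]_n \int[leb]_z h (z, n))%E.
Proof.
move=> mh h0 hz.
have mh3 : measurable_fun setT (fun l : mR * mR * mR => h (l.2, nsq3 l)).
  apply: measurableT_comp => //; apply: measurable_fun_pair => //.
  apply: measurable_funD; last by apply: measurable_funX.
  by apply: measurableT_comp => //; exact: measurable_nsq2.
rewrite (@fubini_tonelli2 _ _ _ _ _ leb2 leb)//.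
rewrite /fubini_G/=.
transitivity (\int[leb]_z (disc_const%:E * \int[leb]_n h (z, n)))%E.
  apply: eq_integral => z _.
  have mhz : measurable_fun setT (fun q : mR => h (z, q + z ^+ 2)).
    apply: measurableT_comp => //; apply: measurable_fun_pair => //.
    by apply: measurable_funD.
  rewrite (@ge0_integral_nsq2 (fun q => h (z, q + z ^+ 2)))//.
  congr (_ * _)%E.
  rewrite (mpres_ge0_integral (mpres_shift (z ^+ 2)) (f := fun n => h (z, n)))//; last first.
    by apply: measurableT_comp => //; apply: measurable_fun_pair.
  rewrite [LHS]integral_mkcond; apply: eq_integral => q _; rewrite patchE.
  case: ifPn => // /negP; rewrite inE/= in_itv/= andbT => q0.
  by rewrite hz//; lra.
rewrite -(fubini_tonelli h mh h0).
apply: (ge0_integralZl leb measurableT (measurable_fun_fubini_tonelli_F h mh h0)).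
- by move=> z _; exact: integral_ge0.
- by rewrite lee_fin ltW// disc_const_gt0.
Qed.

End Radial.

(** * Moments of spherical caps *)

Lemma integral_itv_affine {R : realType} (p q a b : R) : a <= b ->
  (\int[lebesgue_measure]_(x in `[a, b]) (p + q * x)%:E =
   (p * (b - a) + q * (b ^+ 2 - a ^+ 2) / 2)%:E)%E.
Proof.
rewrite le_eqVlt => /predU1P[->|ab].
  by rewrite set_itv1 integral_set1 !subrr !mulr0 mul0r addr0.
pose F x := p * x + q / 2 * x ^+ 2.
have dF (y : R) : is_derive y 1 F (p + q * y).
  by apply: is_derive_eq; rewrite /GRing.scale/= !mulr1; field.
have cF (y : R) : {for y, continuous F}.
  by apply: differentiable_continuous; apply/derivable1_diffP.
rewrite (@continuous_FTC2 _ _ F)//.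
- by rewrite -EFinB; congr EFin; rewrite /F; field.
- apply: continuous_in_subspaceT => x _.
  by apply: continuousD; [exact: cst_continuous|apply: continuousM; [exact: cst_continuous|]].
- split => //.
  + by apply: cvg_at_right_filter; exact: cF.
  + by apply: cvg_at_left_filter; exact: cF.
- by move=> x _; rewrite derive1E; apply: derive_val.
Qed.

Section Cap.
Context {R : realType}.
Local Notation mR := (measurableTypeR R).
Local Notation leb := (@lebesgue_measure R).
Local Notation leb2 := (sprod leb leb).
Local Notation leb3 := (sprod leb2 leb).
Local Notation D := (@disc_const R).

(** Takes the squared norm. The integral of the norm over the unit ball is pi, so dividing by [D]
    gives [rad] total integral 1. *)
Definition ball_weight (n : mR) : mR := if n <= 1 then D^-1 else 0.

Lemma ball_weight_ge0 n : 0 <= ball_weight n.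
Proof.
by rewrite /ball_weight; case: ifPn => // _; rewrite invr_ge0 ltW// disc_const_gt0.
Qed.

Lemma measurable_ball_weight : measurable_fun setT ball_weight.
Proof. by apply: measurable_fun_ifT => //; exact: measurable_fun_ler. Qed.

Lemma measurable_sqrt : measurable_fun setT (Num.sqrt : mR -> mR).
Proof. by apply: continuous_measurable_fun; exact: sqrt_continuous. Qed.

(** The cap integrand in the coordinates [(z, n)], where [n] is the squared norm. The guard
    [z^2 <= n] holds at every point of space and supplies the vanishing that [ge0_integral_nsq3]
    asks for. *)
Definition capfun (c e : R) (l : mR * mR) : mR :=
  if (l.1 ^+ 2 <= l.2) && (c * Num.sqrt l.2 <= l.1)
  then ball_weight l.2 * (Num.sqrt l.2 + e * l.1) else 0.

Lemma capfun_ge0 c e l : 0 <= e <= 1 -> 0 <= capfun c e l.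
Proof.
move=> e01; rewrite /capfun; case: ifPn => // /andP[zn _].
rewrite mulr_ge0 ?ball_weight_ge0//.
have : `|l.1| <= Num.sqrt l.2 by rewrite -sqrtr_sqr ler_sqrt// (le_trans (sqr_ge0 _) zn).
rewrite ler_norml => /andP[? ?]; nra.
Qed.

(** For [n] in [0,1], [z] runs over [c sqrt(n), sqrt(n)] and the inner integral of an affine
    function is [D^-1 * K * n]; integrating [n] over [0,1] then gives the factor 1/2. *)
Lemma integral_capfun c e : -1 <= c <= 1 ->
  (\int[leb]_n \int[leb]_z (capfun c e (z, n))%:E =
   (D^-1 * ((1 - c) + e * (1 - c ^+ 2) / 2) / 2)%:E)%E.
Proof.
move=> c1; have D0 : 0 < D := disc_const_gt0.
set K := (1 - c) + e * (1 - c ^+ 2) / 2.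
transitivity (\int[leb]_(n in `[0%R, 1%R]) (0 + D^-1 * K * n)%:E)%E; last first.
  by rewrite integral_itv_affine//; congr EFin; lra.
rewrite [RHS]integral_mkcond; apply: eq_integral => n _; rewrite patchE.
(* Outside [0,1] the integrand is zero: by the weight if [n > 1], by the guard if [n < 0]. *)
have [n01|n01] := boolP (0 <= n <= 1); last first.
  rewrite ifF; last by apply/negbTE; rewrite notin_setE/= in_itv/=; apply/negP.
  apply: integral0_eq => z _; rewrite /capfun/= /ball_weight.
  case: ifPn => // /andP[zn _]; case: ifPn; rewrite ?mul0r// => n1.
  by case/negP: n01; rewrite n1 (le_trans (sqr_ge0 z) zn).
rewrite ifT; last by rewrite inE/= in_itv.
have n0 : 0 <= n by lra.
set r := Num.sqrt n; have r0 : 0 <= r by exact: sqrtr_ge0.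
have rr : r ^+ 2 = n by rewrite sqr_sqrtr.
pose w := ball_weight n.
transitivity (\int[leb]_(z in `[(c * r)%R, r]) (w * r + w * e * z)%:E)%E; last first.
  rewrite integral_itv_affine; last nra.
  congr EFin; case/andP: n01 => _ n1; rewrite /w /ball_weight n1 -rr /K; field; lra.
rewrite [RHS]integral_mkcond; apply: eq_integral => z _; rewrite patchE /capfun/=.
rewrite -/r -/w mem_setE in_itv/=.
(* Since [c >= -1], the cap condition already implies [- r <= z], so the guard only adds
   [z <= r]. *)
have -> : (z ^+ 2 <= n) && (c * r <= z) = (c * r <= z <= r).
  rewrite andbC; case: (leP (c * r) z) => //= cz.
  have zr' : - r <= z.
    by apply: le_trans cz; rewrite -mulN1r ler_wpM2r//; case/andP: c1.
  rewrite -rr; apply/idP/idP => [zr2|zr]; last nra.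
  by rewrite leNgt; apply/negP => rz; nra.
by case: ifPn => // _; congr EFin; ring.
Qed.

End Cap.

Definition o0 : 'I_3 := Ordinal (isT : (0 < 3)%N).
Definition o1 : 'I_3 := Ordinal (isT : (1 < 3)%N).
Definition o2 : 'I_3 := Ordinal (isT : (2 < 3)%N).

Lemma sum_ord3 (V : nmodType) (F : 'I_3 -> V) : \sum_(k < 3) F k = F o0 + F o1 + F o2.
Proof.
rewrite !big_ord_recr big_ord0/= add0r.
by congr (F _ + F _ + F _); apply: val_inj.
Qed.

Lemma ord3_ind (P : 'I_3 -> Prop) : P o0 -> P o1 -> P o2 -> forall k, P k.
Proof.
move=> P0 P1 P2 k.
have [E|[E|E]] : k = o0 \/ k = o1 \/ k = o2; rewrite ?E //.
by case: k => -[|[|[|//]]] ?; [left|right; left|right; right]; exact: val_inj.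
Qed.

(** * The hidden variable in the ball and rotations of the vertical axis *)

Section Ball.
Context {R : realType}.
Local Notation mR := (measurableTypeR R).
Local Notation leb := (@lebesgue_measure R).
Local Notation leb2 := (sprod leb leb).
Local Notation leb3 := (sprod leb2 leb).
Implicit Types (l : mR * mR * mR) (t : 'I_3 -> R).

Definition coord l (k : 'I_3) : mR := nth 0 [:: l.1.1; l.1.2; l.2] k.
Definition rad l : mR := ball_weight (nsq3 l) * Num.sqrt (nsq3 l).
Definition vec (k : 'I_3) l : mR := ball_weight (nsq3 l) * coord l k.
Definition cap t (c : R) l : bool := c * Num.sqrt (nsq3 l) <= dot3 t (coord l).

(** [G] takes the vertical axis to [t]: first a tilt by the colatitude, with cosine [t o2] and sine
    [s], then a turn by the azimuth. In the last clause [a] and [b] stay unspecified because the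
    horizontal moments they multiply vanish. *)
Lemma rotation_exists t : unit3 t ->
  exists G, [/\ mpres leb3 leb3 G, forall l, nsq3 (G l) = nsq3 l,
    forall l, dot3 t (coord (G l)) = l.2 &
    forall k, exists a b, forall l,
      coord (G l) k = a * l.1.1 + b * l.1.2 + t k * l.2].
Proof.
rewrite /unit3 sum_ord3 => t1; pose s := Num.sqrt (t o0 ^+ 2 + t o1 ^+ 2).
have ss : s ^+ 2 = t o0 ^+ 2 + t o1 ^+ 2 by rewrite sqr_sqrtr// addr_ge0// sqr_ge0.
have [c' [s' [cs' ts' tc']]] :
    exists c' s', [/\ c' ^+ 2 + s' ^+ 2 = 1, t o0 = s * s' & t o1 = - (s * c')].
  (* At a pole the azimuth is arbitrary; the zero angle is taken. *)
  have [s0|s0] := eqVneq s 0.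
    exists 1, 0; split; rewrite ?s0 ?mul0r ?oppr0; first by ring.
      by apply/eqP; rewrite -sqrf_eq0; apply/eqP; rewrite s0 in ss; nra.
    by apply/eqP; rewrite -sqrf_eq0; apply/eqP; rewrite s0 in ss; nra.
  exists (- t o1 / s), (t o0 / s); split; [|by field|by field].
  by rewrite !exprMn exprVn ss sqrrN -mulrDl addrC divff// -ss sqrf_eq0.
have cs : t o2 ^+ 2 + s ^+ 2 = 1 by rewrite ss; lra.
exists (rotxy c' s' \o rotyz (t o2) s); split.
- exact: mpres_comp (mpres_rotyz cs) (mpres_rotxy cs').
- move=> [[x y] z]; rewrite /nsq3 /nsq2 /=.
  transitivity ((c' ^+ 2 + s' ^+ 2) * x ^+ 2 + (c' ^+ 2 + s' ^+ 2) * (t o2 * y - s * z) ^+ 2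
     + (s * y + t o2 * z) ^+ 2); first by ring.
  rewrite cs' !mul1r.
  transitivity (x ^+ 2 + (t o2 ^+ 2 + s ^+ 2) * y ^+ 2 +
    (t o2 ^+ 2 + s ^+ 2) * z ^+ 2); first by ring.
  by rewrite cs !mul1r.
- move=> [[x y] z]; rewrite /dot3 sum_ord3 /coord/= ts' tc'.
  transitivity ((1 - (c' ^+ 2 + s' ^+ 2)) * t o2 * s * y +
     ((c' ^+ 2 + s' ^+ 2) * s ^+ 2 + t o2 ^+ 2) * z); first by ring.
  by rewrite cs' subrr !mul0r add0r mul1r addrC cs mul1r.
- apply: ord3_ind.
  + exists c', (- (s' * t o2)) => -[[x y] z]; rewrite /coord/= ts'; ring.
  + exists s', (c' * t o2) => -[[x y] z]; rewrite /coord/= tc'; ring.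
  + exists 0, s => -[[x y] z]; rewrite /coord/=; ring.
Qed.

Lemma nsq3_ge0 l : 0 <= nsq3 l.
Proof. by rewrite /nsq3 /nsq2 !addr_ge0// sqr_ge0. Qed.

Lemma nsq3_coord l : nsq3 l = \sum_(k < 3) coord l k ^+ 2.
Proof. by rewrite sum_ord3. Qed.

Lemma rad_ge0 l : 0 <= rad l.
Proof. by rewrite mulr_ge0 ?ball_weight_ge0 ?sqrtr_ge0. Qed.

(** This is the purity of the hidden states, from which their positivity follows; it also bounds
    [vec] by the integrable [rad]. *)
Lemma sum_vec_sqr l : \sum_(k < 3) vec k l ^+ 2 = rad l ^+ 2.
Proof.
rewrite /vec /rad exprMn sqr_sqrtr ?nsq3_ge0// nsq3_coord mulr_sumr.
by apply: eq_bigr => k _; rewrite exprMn.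
Qed.

Lemma vec_le_rad k l : `|vec k l| <= rad l.
Proof.
rewrite -[leRHS]ger0_norm ?rad_ge0// -ler_sqr ?nnegrE// !real_normK ?num_real//.
by rewrite -sum_vec_sqr (bigD1 k)//= lerDl sumr_ge0// => i _; rewrite sqr_ge0.
Qed.

Lemma measurable_coord k : measurable_fun setT (coord^~ k).
Proof.
elim/ord3_ind: k; rewrite /coord/=.
- by apply: measurableT_comp; [exact: measurable_fst|exact: measurable_fst].
- by apply: measurableT_comp; [exact: measurable_snd|exact: measurable_fst].
- exact: measurable_snd.
Qed.

Lemma measurable_nsq3 : measurable_fun setT (@nsq3 R).
Proof.
apply: measurable_funD; last by apply: measurable_funX; exact: measurable_snd.
by apply: measurableT_comp; [exact: measurable_nsq2|exact: measurable_fst].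
Qed.

Lemma measurable_rad : measurable_fun setT rad.
Proof.
apply: measurable_funM; apply: measurableT_comp; try exact: measurable_nsq3.
- exact: measurable_ball_weight.
- exact: measurable_sqrt.
Qed.

Lemma measurable_vec k : measurable_fun setT (vec k).
Proof.
apply: measurable_funM; last exact: measurable_coord.
apply: measurableT_comp; [exact: measurable_ball_weight|exact: measurable_nsq3].
Qed.

Lemma measurable_cap t c : measurable_fun setT (cap t c).
Proof.
apply: measurable_fun_ler.
  apply: measurable_funM => //.
  by apply: measurableT_comp; [exact: measurable_sqrt|exact: measurable_nsq3].
under eq_fun do rewrite /dot3 sum_ord3.
by apply: measurable_funD; [apply: measurable_funD|];
  apply: measurable_funM => //; exact: measurable_coord.
Qed.

(* The slope [e] serves to separate [rad] ([e = 0]) from [vec] ([e = 1]) while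
   keeping the integrand nonnegative, so that Tonelli applies. *)
Lemma integral_vertical_cap c e : -1 <= c <= 1 -> 0 <= e <= 1 ->
  (\int[leb3]_l (if (c * Num.sqrt (nsq3 l) <= l.2)%R
     then (rad l + e * vec o2 l)%R else 0%R)%:E =
   (((1 - c) + e * (1 - c ^+ 2) / 2) / 2)%:E)%E.
Proof.
move=> c1 e1; have D0 := @disc_const_gt0 R.
transitivity (\int[leb3]_l (EFin \o capfun c e) (l.2, nsq3 l))%E.
  apply: eq_integral => l _; congr EFin; rewrite /capfun/=.
  rewrite (_ : l.2 ^+ 2 <= nsq3 l); last first.
    by rewrite /nsq3 lerDr /nsq2 addr_ge0// sqr_ge0.
  by case: ifPn => // _; rewrite /rad /vec /coord/=; ring.
rewrite ge0_integral_nsq3.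
- rewrite [X in (_ * X)%E](integral_capfun e c1) -EFinM; congr EFin.
  by field; rewrite gt_eqF.
- apply: measurableT_comp => //; apply: measurable_fun_ifT => //.
    apply: measurable_and; apply: measurable_fun_ler => //.
      by apply: measurable_funX.
    by apply: measurable_funM => //; apply: measurableT_comp => //; exact: measurable_sqrt.
  apply: measurable_funM.
    by apply: measurableT_comp => //; exact: measurable_ball_weight.
  apply: measurable_funD; last by apply: measurable_funM.
  by apply: measurableT_comp => //; exact: measurable_sqrt.
- by move=> l; rewrite lee_fin capfun_ge0.
- by move=> z n zn; rewrite /= /capfun/= leNgt zn.
Qed.

End Ball.

(** * Weights and Bloch vectors of caps, and the response functions *)

Section Moments.
Context {R : realType}.
Local Notation mR := (measurableTypeR R).
Local Notation leb := (@lebesgue_measure R).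
Local Notation leb2 := (sprod leb leb).
Local Notation leb3 := (sprod leb2 leb).
Implicit Types (l : mR * mR * mR) (t u : 'I_3 -> R).

Lemma vertical_le l : - Num.sqrt (nsq3 l) <= l.2.
Proof.
have : `|l.2| <= Num.sqrt (nsq3 l).
  rewrite -sqrtr_sqr ler_sqrt ?nsq3_ge0// /nsq3 lerDr /nsq2.
  by rewrite addr_ge0// sqr_ge0.
by rewrite ler_norml => /andP[].
Qed.

(** For [c = -1] the cap is the whole space, by [vertical_le]. *)
Lemma integral_rad : (\int[leb3]_l (rad l)%:E = 1)%E.
Proof.
have := @integral_vertical_cap R (-1) 0 ltac:(lra) ltac:(lra).
rewrite (_ : _ / 2 = 1); last by field.
move=> <-; apply: eq_integral => l _; congr EFin.
by rewrite mulN1r vertical_le mul0r addr0.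
Qed.

Lemma integrable_rad : leb3.-integrable setT (EFin \o rad).
Proof.
apply/integrableP; split; first by apply/measurable_EFinP; exact: measurable_rad.
under eq_integral => l _ do rewrite /= ger0_norm ?rad_ge0//.
by rewrite integral_rad ltry.
Qed.

Lemma integrable_vec k : leb3.-integrable setT (EFin \o vec k).
Proof.
apply: (le_integrable measurableT _ _ integrable_rad).
  by apply/measurable_EFinP; exact: measurable_vec.
by move=> l _; rewrite /= lee_fin (ger0_norm (rad_ge0 l)) vec_le_rad.
Qed.

Lemma integrable_if (b : mR * mR * mR -> bool) (f : mR * mR * mR -> mR) :
  measurable_fun setT b -> leb3.-integrable setT (EFin \o f) ->
  leb3.-integrable setT (EFin \o (fun l => if b l then f l else 0)).
Proof.
move=> mb fi; apply: (le_integrable measurableT _ _ fi).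
  apply/measurable_EFinP; apply: measurable_fun_ifT => //.
  by case/integrableP : fi => /measurable_EFinP.
by move=> l _; rewrite /= lee_fin; case: ifPn => // _; rewrite normr0.
Qed.

Definition vcap (c : R) l : bool := c * Num.sqrt (nsq3 l) <= l.2.

Lemma measurable_vcap c : measurable_fun setT (vcap c).
Proof.
apply: measurable_fun_ler; last exact: measurable_snd.
apply: measurable_funM => //.
by apply: measurableT_comp; [exact: measurable_sqrt|exact: measurable_nsq3].
Qed.

Lemma vcap_rad c : -1 <= c <= 1 ->
  \int[leb3]_l (if vcap c l then rad l else 0) = (1 - c) / 2.
Proof.
move=> c1; have := @integral_vertical_cap R c 0 c1 ltac:(lra); rewrite mul0r mul0r addr0 => E.
rewrite /Rintegral -[RHS]/(fine ((1 - c) / 2)%:E) -E; congr fine.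
by apply: eq_integral => l _; rewrite mul0r addr0.
Qed.

Lemma vcap_vec c k : -1 <= c <= 1 ->
  \int[leb3]_l (if vcap c l then vec k l else 0) =
  if k == o2 then (1 - c ^+ 2) / 4 else 0.
Proof.
move=> c1; have ir := integrable_if (measurable_vcap c) integrable_rad.
have iv j := integrable_if (measurable_vcap c) (integrable_vec j).
have [->|k2] := eqVneq k o2.
  (* The vertical moment is the formula for [e = 1] minus the one for [e = 0]. *)
  have := vcap_rad c1; have := @integral_vertical_cap R c 1 c1 ltac:(lra) => E Er.
  have : \int[leb3]_l ((if vcap c l then rad l else 0) + (if vcap c l then vec o2 l else 0))
      = ((1 - c) + 1 * (1 - c ^+ 2) / 2) / 2.
    rewrite /Rintegral -[RHS]/(fine (((1 - c) + 1 * (1 - c ^+ 2) / 2) / 2)%:E) -E; congr fine.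
    apply: eq_integral => l _; congr EFin; rewrite -/(vcap c l).
    by case: ifPn => _; rewrite ?mul1r ?addr0.
  by rewrite (RintegralD measurableT ir (iv o2)) Er => h; lra.
(* The half-turn about the vertical axis preserves the cap and negates the horizontal coordinates,
   so a horizontal moment equals its own opposite. *)
have rot : mpres leb3 leb3 (rotxy (-1) 0) by apply: mpres_rotxy; ring.
set I := LHS; suff : I = - I by lra.
rewrite -mulN1r /I -RintegralZl//; last exact: iv.
apply: etrans (mpres_Rintegral rot (iv k)) _.
apply: eq_Rintegral => l _.
have nr : nsq3 (rotxy (-1) 0 l) = nsq3 l by rewrite /nsq3 /nsq2 /=; ring.
have -> : vcap c (rotxy (-1) 0 l) = vcap c l by rewrite /vcap nr.
case: ifPn => _; rewrite ?mulr0// /vec nr mulrCA; congr (_ * _).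
by elim/ord3_ind: k k2 {iv I} => //= _; rewrite /coord/=; ring.
Qed.

Lemma cap_rad t c : unit3 t -> -1 <= c <= 1 ->
  \int[leb3]_l (if cap t c l then rad l else 0) = (1 - c) / 2.
Proof.
move=> t1 c1; have [G [mG nG dG _]] := rotation_exists t1.
apply: etrans (mpres_Rintegral mG (integrable_if (measurable_cap t c) integrable_rad)) _.
rewrite -(vcap_rad c1); apply: eq_Rintegral => l _.
by rewrite /cap /rad nG dG.
Qed.

(** After rotation the cap is vertical and coordinate [k] becomes [a x + b y + t_k z], of which only
    the vertical moment survives. *)
Lemma cap_vec t c k : unit3 t -> -1 <= c <= 1 ->
  \int[leb3]_l (if cap t c l then vec k l else 0) = (1 - c ^+ 2) / 4 * t k.
Proof.
move=> t1 c1; have [G [mG nG dG cG]] := rotation_exists t1.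
have iv j := integrable_if (measurable_vcap c) (integrable_vec j).
have ivZ r j : leb3.-integrable setT
    (EFin \o (fun l => r * (if vcap c l then vec j l else 0))).
  have := integrableZl measurableT r (iv j); apply: eq_integrable => // l _.
have [a [b {}cG]] := cG k.
apply: etrans (mpres_Rintegral mG (integrable_if (measurable_cap t c) (integrable_vec k))) _.
transitivity (\int[leb3]_l (a * (if vcap c l then vec o0 l else 0) +
   b * (if vcap c l then vec o1 l else 0) + t k * (if vcap c l then vec o2 l else 0))).
  apply: eq_Rintegral => l _; rewrite /cap /vec nG dG cG /vcap /coord/=.
  by case: ifPn => _; ring.
have iab : leb3.-integrable setT (EFin \o (fun l =>
    a * (if vcap c l then vec o0 l else 0) + b * (if vcap c l then vec o1 l else 0))).
  have := integrableD measurableT (ivZ a o0) (ivZ b o1); exact: eq_integrable.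
rewrite (RintegralD measurableT iab (ivZ (t k) o2)).
rewrite (RintegralD measurableT (ivZ a o0) (ivZ b o1)).
rewrite (RintegralZl _ measurableT (iv o0)) (RintegralZl _ measurableT (iv o1)).
rewrite (RintegralZl _ measurableT (iv o2)) !vcap_vec//= !mulr0 !add0r.
by rewrite mulrC.
Qed.

Lemma Rintegral_rad : \int[leb3]_l rad l = 1.
Proof. by rewrite /Rintegral integral_rad. Qed.

Lemma Rintegral_vec k : \int[leb3]_l vec k l = 0.
Proof.
have := @vcap_vec (-1) k ltac:(lra); rewrite sqrrN expr1n subrr mul0r if_same => E.
rewrite -[RHS]E; apply: eq_Rintegral => l _.
by rewrite /vcap mulN1r vertical_le.
Qed.

(** Used with [b = a.x] and [u = T x]: the two integrals are the weight and Bloch vector that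
    outcome + must produce. *)
Lemma response_exists (b : R) u :
  b ^+ 2 + 2 * Num.sqrt (\sum_(k < 3) u k ^+ 2) <= 1 ->
  exists p : mR * mR * mR -> mR, [/\ measurable_fun setT p,
    forall l, 0 <= p l <= 1,
    \int[leb3]_l (p l * rad l) = (1 + b) / 2 &
    forall k, \int[leb3]_l (p l * vec k l) = u k / 2].
Proof.
set m := Num.sqrt _ => bm; have m0 : 0 <= m := sqrtr_ge0 _.
have b1 : -1 <= - b <= 1 by nra.
have mm : m ^+ 2 = \sum_(k < 3) u k ^+ 2.
  by rewrite sqr_sqrtr// sumr_ge0// => k _; rewrite sqr_ge0.
have [t [s [t1 s1 ut]]] : exists t s, [/\ unit3 t, 0 <= s <= 1 &
    forall k, s * ((1 - b ^+ 2) / 4) * t k = u k / 2].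
  (* Here [u = 0], so [s = 0] with any [t] works. This also settles [b^2 = 1], which the inequality
     forces into this case; otherwise [1 - b^2] is a legitimate divisor. *)
  have [me|me] := eqVneq m 0.
    exists (fun k => if k == o0 then 1 else 0), 0; split; last 2 first.
    - by rewrite lexx ler01.
    - move=> k; rewrite !mul0r; suff -> : u k = 0 by rewrite mul0r.
      apply/eqP; rewrite -sqrf_eq0; apply/eqP; move: mm; rewrite me expr0n.
      move=> /esym/eqP; rewrite psumr_eq0 => [/allP/(_ k (mem_index_enum k))/eqP//|].
      by move=> i _; rewrite sqr_ge0.
    by rewrite /unit3 sum_ord3/= !expr0n expr1n !addr0.
  have b2 : 0 < 1 - b ^+ 2 by have : 0 < m by [rewrite lt_def me]; lra.
  (* [s] shrinks the Bloch vector [(1 - b^2) / 4 * t] of the cap to [u / 2]. *)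
  exists (fun k => u k / m), (2 * m / (1 - b ^+ 2)); split.
  - rewrite /unit3; under eq_bigr do rewrite exprMn.
    by rewrite -mulr_suml -mm exprVn divff// sqrf_eq0.
  - apply/andP; split; first by apply: divr_ge0; [exact: mulr_ge0|exact: ltW].
    by rewrite ler_pdivrMr// mul1r; lra.
  - by move=> k; field; rewrite me gt_eqF.
(* The cap with [c = - b] has weight [(1 + b) / 2], of which a fraction [s] is kept; [q] is the
   constant answer restoring the rest. It adds no Bloch vector, as [vec] integrates to zero. *)
pose q := (1 - s) * (1 + b) / 2.
have q0 : 0 <= q by rewrite /q divr_ge0// mulr_ge0; lra.
have q1 : q <= 1 - s by rewrite /q ler_pdivrMr// ler_wpM2l; lra.
have ic := fun f fi => @integrable_if (cap t (- b)) f (measurable_cap t (- b)) fi.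
have main f : leb3.-integrable setT (EFin \o f) ->
    \int[leb3]_l ((if cap t (- b) l then s + q else q) * f l) =
    s * \int[leb3]_l (if cap t (- b) l then f l else 0) + q * \int[leb3]_l f l.
  move=> fi; rewrite -!RintegralZl//; last exact: ic.
  rewrite -RintegralD//.
  - by apply: eq_Rintegral => l _; case: ifPn => _; ring.
  - exact: (integrableZl measurableT s (ic _ fi)).
  - exact: (integrableZl measurableT q fi).
exists (fun l => if cap t (- b) l then s + q else q); split.
- by apply: measurable_fun_ifT => //; exact: measurable_cap.
- by move=> l; case: ifPn => _; move: s1 q0 q1; clearbody q; clear; lra.
- rewrite main; last exact: integrable_rad.
  by rewrite cap_rad// Rintegral_rad /q; field.
- move=> k; rewrite main; last exact: integrable_vec.
  by rewrite cap_vec// Rintegral_vec mulr0 addr0 sqrrN mulrA ut.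
Qed.

End Moments.

(** * Two-qubit algebra *)

Section Qubit.
Context {R : realType}.
Local Notation C := (complex R).
Implicit Types (a T x v : 'I_3 -> R).

Lemma idx2_lt4 (i j : 'I_2) : (2 * i + j < 4)%N.
Proof. exact: (leq_add (leq_mul (leqnn 2) (ltn_ord i : i <= 1)%N) (ltn_ord j : j <= 1)%N). Qed.

Lemma hiA_idx2 i j : hiA (idx2 i j) = i.
Proof.
have ij := idx2_lt4 i j; apply: val_inj.
have E : ((2 * i + j) %/ 2 = i)%N by rewrite mulnC divnMDl// divn_small ?addn0.
by rewrite /hiA /idx2 /= [in LHS]inordK inordK// E.
Qed.

Lemma loB_idx2 i j : loB (idx2 i j) = j.
Proof.
apply: val_inj; rewrite /loB /idx2 /= [in LHS]inordK ?ltn_mod// inordK ?idx2_lt4//.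
by rewrite mulnC modnMDl modn_small.
Qed.

Lemma idx2K : cancel (fun p : 'I_2 * 'I_2 => idx2 p.1 p.2) (fun k => (hiA k, loB k)).
Proof. by move=> [i j]; rewrite /= hiA_idx2 loB_idx2. Qed.

(** [idx2] is injective between sets of four elements, hence a bijective reindexing. *)
Lemma sum_idx2 (F : 'I_2 -> 'I_2 -> C) :
  \sum_(k < 4) F (hiA k) (loB k) = \sum_(i < 2) \sum_(j < 2) F i j.
Proof.
have bij : bijective (fun p : 'I_2 * 'I_2 => idx2 p.1 p.2).
  by apply: inj_card_bij; [exact: can_inj idx2K|rewrite card_prod !card_ord].
rewrite pair_big/= (reindex (fun p : 'I_2 * 'I_2 => idx2 p.1 p.2)); last exact: onW_bij.
by apply: eq_bigr => -[i j] _; rewrite hiA_idx2 loB_idx2.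
Qed.

Lemma kron_mulmx (A B E F : 'M[C]_2) : kron A B *m kron E F = kron (A *m E) (B *m F).
Proof.
apply/matrixP => k l; rewrite !mxE big_distrlr/=.
rewrite -(sum_idx2 (fun i j => A (hiA k) i * E i (hiA l) * (B (loB k) j * F j (loB l)))).
by apply: eq_bigr => i _; rewrite !mxE mulrACA.
Qed.

Lemma ptrA_kron (A B : 'M[C]_2) : ptrA (kron A B) = \tr A *: B.
Proof.
apply/matrixP => i j; rewrite !mxE mulr_suml.
by apply: eq_bigr => k _; rewrite !mxE !hiA_idx2 !loB_idx2.
Qed.

Lemma ptrAD (M N : 'M[C]_4) : ptrA (M + N) = ptrA M + ptrA N.
Proof.
apply/matrixP => i j; rewrite !mxE -big_split/=.
by apply: eq_bigr => k _; rewrite mxE.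
Qed.

Lemma ptrAZ (c : C) (M : 'M[C]_4) : ptrA (c *: M) = c *: ptrA M.
Proof.
apply/matrixP => i j; rewrite !mxE mulr_sumr.
by apply: eq_bigr => k _; rewrite mxE.
Qed.

Lemma ptrA_sum (F : 'I_3 -> 'M[C]_4) : ptrA (\sum_k F k) = \sum_k ptrA (F k).
Proof. by rewrite !sum_ord3 !ptrAD. Qed.

Lemma rCE (r : R) : rC r = r%:C%C. Proof. by []. Qed.

Lemma trace_pauli k : \tr (pauli R k) = 0.
Proof.
by elim/ord3_ind: k; rewrite /mxtrace !big_ord_recr big_ord0/= !mxE/=; ring.
Qed.

Lemma trace_pauli_mul j k : \tr (pauli R j *m pauli R k) = if j == k then 2 else 0.
Proof.
have ii : iC R * iC R = -1.
  by apply/eqP; rewrite eq_complex /=; apply/andP; split; apply/eqP; ring.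
elim/ord3_ind: j; elim/ord3_ind: k;
  rewrite /mxtrace !big_ord_recr big_ord0/= !mxE !big_ord_recr !big_ord0/= !mxE/=.
all: rewrite ?mulrN ?mulNr ?ii; ring.
Qed.

Lemma trace_bloch v : \tr (bloch v) = 0.
Proof.
by rewrite /bloch sum_ord3 !linearD/= !linearZ/= !trace_pauli !mulr0 !addr0.
Qed.

Lemma trace_bloch_pauli v k : \tr (bloch v *m pauli R k) = rC (2 * v k).
Proof.
rewrite /bloch mulmx_suml raddf_sum /= (bigD1 k)//= big1 => [|j jk].
  by rewrite -scalemxAl linearZ/= trace_pauli_mul eqxx addr0 !rCE rmorphM rmorph_nat mulrC.
by rewrite -scalemxAl linearZ/= trace_pauli_mul (negbTE jk) mulr0.
Qed.

Lemma trace_bloch_mul u v : \tr (bloch u *m bloch v) = rC (2 * dot3 u v).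
Proof.
rewrite {2}/bloch mulmx_sumr raddf_sum /= /dot3 mulr_sumr rCE rmorph_sum/=.
apply: eq_bigr => k _; rewrite -scalemxAr linearZ/= trace_bloch_pauli !rCE -rmorphM/=.
by congr (_%:C%C); ring.
Qed.

(** Common form of the hidden states and of the assemblage: [r] is the weight (the trace) and [v]
    the unnormalised Bloch vector. *)
Definition qubit_op (r : R) v : 'M[C]_2 := rC 2^-1 *: (rC r *: 1%:M + bloch v).

Definition outcome_sign (o : bool) : R := if o then 1 else -1.

Lemma projME x o : projM x o = rC 2^-1 *: (1%:M + rC (outcome_sign o) *: bloch x).
Proof. by rewrite /projM /outcome_sign; case: o; rewrite !rCE ?rmorphN ?rmorph1. Qed.

(** Since [ptrA] of a tensor product is a trace times Bob's factor, Alice's projector enters only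
    through its traces against 1, [bloch a] and the Pauli matrices. *)
Lemma assemblage_canon a T x o :
  assemblage (canon_state a T) x o =
  qubit_op ((1 + outcome_sign o * dot3 a x) / 2) (fun k => outcome_sign o * (T k * x k) / 2).
Proof.
rewrite /assemblage projME; set e := outcome_sign o.
set P := rC 2^-1 *: _.
have trP : \tr P = 1.
  rewrite linearZ/= linearD/= linearZ/= mxtrace1 trace_bloch mulr0 addr0 rCE.
  by rewrite -(rmorph_nat (real_complex R)) -rmorphM mulVf ?rmorph1.
have trPs k : \tr (P *m pauli R k) = rC (e * x k).
  rewrite /P -scalemxAl linearZ/= mulmxDl mul1mx linearD/= trace_pauli add0r.
  rewrite -scalemxAl linearZ/= trace_bloch_pauli !rCE -!rmorphM; congr (_%:C%C).
  by field.
have trPa : \tr (P *m bloch a) = rC (e * dot3 a x).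
  rewrite /P -scalemxAl linearZ/= mulmxDl mul1mx linearD/= trace_bloch add0r.
  rewrite -scalemxAl linearZ/= trace_bloch_mul !rCE -!rmorphM; congr (_%:C%C).
  rewrite (_ : dot3 x a = dot3 a x); first by field.
  by apply: eq_bigr => k _; rewrite mulrC.
rewrite /canon_state -scalemxAr ptrAZ !mulmxDr !ptrAD mulmx_sumr ptrA_sum.
rewrite !kron_mulmx !ptrA_kron !mulmx1 trP trPa.
under eq_bigr do rewrite -scalemxAr ptrAZ kron_mulmx ptrA_kron mul1mx trPs scalerA.
rewrite /qubit_op /bloch.
rewrite [LHS]scalerDr [RHS]scalerDr; congr (_ + _).
  rewrite -scalerDl !scalerA; congr (_ *: _).
  rewrite -(rmorph1 (real_complex R)) !rCE -rmorphD -!rmorphM; congr (_%:C%C).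
  by field.
rewrite !scaler_sumr; apply: eq_bigr => k _; rewrite !scalerA; congr (_ *: _).
by rewrite !rCE -!rmorphM; congr (_%:C%C); field.
Qed.

Lemma ptrA_canon a T : ptrA (canon_state a T) = qubit_op 1 (fun=> 0).
Proof.
rewrite /canon_state ptrAZ !ptrAD ptrA_sum !ptrA_kron trace_bloch scale0r addr0.
under eq_bigr do rewrite ptrAZ ptrA_kron trace_pauli scale0r scaler0.
rewrite big1// addr0 mxtrace1 /qubit_op /bloch big1 => [|k _]; last first.
  by rewrite rCE rmorph0 scale0r.
rewrite addr0 !scalerA; congr (_ *: _).
by rewrite -(rmorph_nat (real_complex R)) !rCE -!rmorphM; congr (_%:C%C); field.
Qed.

Lemma trace_qubit_op r v : \tr (qubit_op r v) = rC r.
Proof.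
rewrite linearZ/= linearD/= linearZ/= mxtrace1 trace_bloch addr0 !rCE.
by rewrite -(rmorph_nat (real_complex R)) -!rmorphM; congr (_%:C%C); field.
Qed.

Lemma Re_scale (c : R) (z : C) : complex.Re (rC c * z) = c * complex.Re z.
Proof. by case: z => p q; rewrite /= mul0r subr0. Qed.

Lemma Im_scale (c : R) (z : C) : complex.Im (rC c * z) = c * complex.Im z.
Proof. by case: z => p q; rewrite /= mul0r addr0. Qed.

(** Each entry is a fixed real linear form in [r] and [v], so integrals of hidden states reduce to
    moments of [rad] and [vec]. *)
Lemma Re_qubit_op r v i j : complex.Re (qubit_op r v i j) =
  2^-1 * (r * complex.Re ((1%:M : 'M[C]_2) i j) + \sum_k v k * complex.Re (pauli R k i j)).
Proof.
rewrite /qubit_op /bloch sum_ord3 !mxE Re_scale !raddfD/= !Re_scale sum_ord3.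
by rewrite !mxE.
Qed.

Lemma Im_qubit_op r v i j : complex.Im (qubit_op r v i j) =
  2^-1 * (r * complex.Im ((1%:M : 'M[C]_2) i j) + \sum_k v k * complex.Im (pauli R k i j)).
Proof.
rewrite /qubit_op /bloch sum_ord3 !mxE Im_scale !raddfD/= !Im_scale sum_ord3.
by rewrite !mxE.
Qed.

Lemma ord2_ind (P : 'I_2 -> Prop) : P 0 -> P 1 -> forall i, P i.
Proof.
move=> P0 P1; case=> -[|[|//]] hi.
- by rewrite (_ : Ordinal hi = 0) //; exact: val_inj.
- by rewrite (_ : Ordinal hi = 1) //; exact: val_inj.
Qed.

Lemma qubit_opE r v : qubit_op r v = \matrix_(i, j)
  (if i == 0 then if j == 0 then Complex ((r + v o2) / 2) 0
                  else Complex (v o0 / 2) (- v o1 / 2)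
   else if j == 0 then Complex (v o0 / 2) (v o1 / 2)
        else Complex ((r - v o2) / 2) 0).
Proof.
apply/matrixP => i j.
have -> : qubit_op r v i j =
    Complex (complex.Re (qubit_op r v i j)) (complex.Im (qubit_op r v i j)).
  by case: (qubit_op r v i j).
rewrite Re_qubit_op Im_qubit_op !sum_ord3 !mxE.
by elim/ord2_ind: i; elim/ord2_ind: j => /=; congr Complex; field.
Qed.

(** Twice the quadratic form of a [qubit_op] at a vector (w0, w1), with [p = |w0|^2], [q = |w1|^2]
    and [u + i w = conj(w0) w1]. Cauchy-Schwarz gives [B^2 <= 4 (r^2 - z^2) p q], and the
    arithmetic-geometric mean inequality bounds this by [A^2]. *)
Lemma bloch_form_ge0 (r x y z p q u w : R) : 0 <= r -> 0 <= p -> 0 <= q ->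
  x ^+ 2 + y ^+ 2 + z ^+ 2 = r ^+ 2 -> u ^+ 2 + w ^+ 2 = p * q ->
  0 <= (r + z) * p + (r - z) * q + 2 * (x * u + y * w).
Proof.
move=> r0 p0 q0 xyz uw; set A := _ + _ * q; set B := 2 * _.
have zr : - r <= z <= r.
  rewrite -ler_norml -[leRHS]ger0_norm// -ler_sqr ?nnegrE//.
  by rewrite !real_normK ?num_real//; nra.
have A0 : 0 <= A.
  by rewrite /A; case/andP: zr => *; rewrite addr_ge0// mulr_ge0//; lra.
have BA : B ^+ 2 <= A ^+ 2.
  have CS : (x * u + y * w) ^+ 2 <= (x ^+ 2 + y ^+ 2) * (u ^+ 2 + w ^+ 2).
    rewrite -subr_ge0; have -> : (x ^+ 2 + y ^+ 2) * (u ^+ 2 + w ^+ 2) - (x * u + y * w) ^+ 2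
      = (x * w - y * u) ^+ 2 by ring.
    exact: sqr_ge0.
  rewrite uw (_ : x ^+ 2 + y ^+ 2 = r ^+ 2 - z ^+ 2) in CS; last lra.
  have : 0 <= ((r + z) * p - (r - z) * q) ^+ 2 by exact: sqr_ge0.
  rewrite /A /B; nra.
have : `|B| <= A by rewrite -[A]ger0_norm// -ler_sqr ?nnegrE// !real_normK ?num_real.
by rewrite ler_norml => /andP[? _]; lra.
Qed.

Lemma psd_qubit_op r v : 0 <= r -> \sum_k v k ^+ 2 = r ^+ 2 -> psd (qubit_op r v).
Proof.
move=> r0; rewrite sum_ord3 => vr; split.
  apply/matrixP => i j; rewrite qubit_opE !mxE /cconj.
  elim/ord2_ind: i; elim/ord2_ind: j => /=; congr Complex; ring.
move=> w; rewrite qubit_opE !mxE !big_ord_recr !big_ord0/= !mxE.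
rewrite !big_ord_recr !big_ord0/= !mxE/=.
case: (w _ _) => a b; case: (w _ _) => c d.
set f := complex.Re _.
have -> : f = 2^-1 * ((r + v o2) * (a ^+ 2 + b ^+ 2) + (r - v o2) * (c ^+ 2 + d ^+ 2) +
    2 * (v o0 * (a * c + b * d) + v o1 * (a * d - b * c))).
  by rewrite /f /=; field.
apply: mulr_ge0; first by rewrite invr_ge0.
by apply: bloch_form_ge0; rewrite ?addr_ge0 ?sqr_ge0//; ring.
Qed.

End Qubit.

(** * The local hidden state model *)

Section Model.
Context {R : realType}.
Local Notation mR := (measurableTypeR R).
Local Notation leb := (@lebesgue_measure R).
Local Notation leb2 := (sprod leb leb).
Local Notation leb3 := (sprod leb2 leb).
Implicit Types (l : mR * mR * mR) (p f g : mR * mR * mR -> mR).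

Lemma integrable_response p f : measurable_fun setT p -> (forall l, 0 <= p l <= 1) ->
  leb3.-integrable setT (EFin \o f) ->
  leb3.-integrable setT (EFin \o (fun l => p l * f l)).
Proof.
move=> mp p01 fi; apply: (le_integrable measurableT _ _ fi).
  apply/measurable_EFinP; apply: measurable_funM => //.
  by case/integrableP : fi => /measurable_EFinP.
move=> l _; rewrite /= lee_fin normrM ler_piMl// ger0_norm; by case/andP: (p01 l).
Qed.

Lemma integrable_linear (c e : R) f g :
  leb3.-integrable setT (EFin \o f) -> leb3.-integrable setT (EFin \o g) ->
  leb3.-integrable setT (EFin \o (fun l => c * f l + e * g l)) /\
  \int[leb3]_l (c * f l + e * g l) = c * \int[leb3]_l f l + e * \int[leb3]_l g l.
Proof.
move=> fi gi.
have cf : leb3.-integrable setT (EFin \o (fun l => c * f l)).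
  exact: (integrableZl measurableT c fi).
have eg : leb3.-integrable setT (EFin \o (fun l => e * g l)).
  exact: (integrableZl measurableT e gi).
split; first exact: (integrableD measurableT cf eg).
by rewrite (RintegralD measurableT cf eg) !RintegralZl.
Qed.

(** [h] has the shape of an entry in [Re_qubit_op] and [Im_qubit_op], with [c] and [e] the matching
    entries of the identity and the Pauli matrices. *)
Lemma integral_response p (c : R) (e : 'I_3 -> R) :
  measurable_fun setT p -> (forall l, 0 <= p l <= 1) ->
  let h l := 2^-1 * (rad l * c + \sum_k vec k l * e k) in
  leb3.-integrable setT (fun l => (p l * h l)%:E) /\
  (\int[leb3]_l (p l * h l)%:E =
   (2^-1 * (\int[leb3]_l (p l * rad l) * c +
           \sum_k \int[leb3]_l (p l * vec k l) * e k))%:E)%E.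
Proof.
move=> mp p01 h.
have ir := integrable_response mp p01 (@integrable_rad R).
have iv k := integrable_response mp p01 (@integrable_vec R k).
have [i1 e1] := integrable_linear (2^-1 * c) (2^-1 * e o0) ir (iv o0).
have [i2 e2] := integrable_linear (2^-1 * e o1) (2^-1 * e o2) (iv o1) (iv o2).
have [i3 e3] := integrable_linear 1 1 i1 i2.
have hE : (fun l => 1 * (2^-1 * c * (p l * rad l) + 2^-1 * e o0 * (p l * vec o0 l)) +
    1 * (2^-1 * e o1 * (p l * vec o1 l) + 2^-1 * e o2 * (p l * vec o2 l))) =
    (fun l => p l * h l).
  by apply/funext => l; rewrite /h sum_ord3; ring.
rewrite hE in i3 e3; split => //.
rewrite -[LHS]fineK; last exact: (integrable_fin_num measurableT i3).
congr EFin; apply: etrans e3 _; rewrite e1 e2 sum_ord3; ring.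
Qed.

Lemma unsteerable_canon (a T : 'I_3 -> R) :
  (forall x : 'I_3 -> R, unit3 x ->
     dot3 a x ^+ 2 + 2 * Num.sqrt (\sum_(k < 3) (T k * x k) ^+ 2) <= 1) ->
  unsteerable_AB_proj (canon_state a T).
Proof.
move=> aT; pose mu := leb3.
pose good x (q : mR * mR * mR -> mR) := [/\ measurable_fun setT q,
    forall l, 0 <= q l <= 1,
    \int[mu]_l (q l * rad l) = (1 + dot3 a x) / 2 &
    forall k, \int[mu]_l (q l * vec k l) = T k * x k / 2].
have [f fP] : exists f : ('I_3 -> R) -> mR * mR * mR -> mR,
    forall x, unit3 x -> good x (f x).
  have /boolp.choice[f fP] : forall x, exists q, unit3 x -> good x q.
    (* The zero function is a mere default for vectors [x] that are not unit. *)
    move=> x; have [x1|x1] := pselect (unit3 x); last by exists (cst 0).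
    by have [q qP] := response_exists (aT x x1); exists q.
  by exists f.
pose p x (o : bool) l : mR := if o then f x l else 1 - f x l.
have p01 x o l : unit3 x -> 0 <= p x o l <= 1.
  by case/fP => _ /(_ l) f01 _ _; rewrite /p; case: o; lra.
have mp x o : unit3 x -> measurable_fun setT (p x o).
  by case/fP => mf _ _ _; rewrite /p; case: o => //; apply: measurable_funB.
have p_rad x o : unit3 x -> \int[mu]_l (p x o l * rad l) =
    (1 + outcome_sign o * dot3 a x) / 2.
  move=> x1; have [mf f01 fr _] := fP x x1; case: o; rewrite /p /outcome_sign.
    by rewrite mul1r.
  (* Outcome - has the complementary response, so its moment is the total moment minus that of
     outcome +. *)
  have [_] := integrable_linear 1 (-1) integrable_rad
    (integrable_response mf f01 integrable_rad).
  rewrite Rintegral_rad fr => E; rewrite (_ : _ / 2 = 1 * 1 + -1 * ((1 + dot3 a x) / 2)).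
    by rewrite -E; apply: eq_Rintegral => l _; ring.
  by field.
have p_vec x o k : unit3 x -> \int[mu]_l (p x o l * vec k l) =
    outcome_sign o * (T k * x k) / 2.
  move=> x1; have [mf f01 _ fv] := fP x x1; case: o; rewrite /p /outcome_sign.
    by rewrite mul1r.
  have [_] := integrable_linear 1 (-1) (integrable_vec k)
    (integrable_response mf f01 (integrable_vec k)).
  rewrite Rintegral_vec fv => E; rewrite (_ : _ / 2 = 1 * 0 + -1 * (T k * x k / 2)).
    by rewrite -E; apply: eq_Rintegral => l _; ring.
  by field.
pose sig (l : mR * mR * mR) := qubit_op (rad l) (fun k => vec k l).
(* The constant response 1 turns [integral_response] into the integrability of the hidden states and
   the trivial measurement. *)
pose one (l : mR * mR * mR) : mR := 1.
have one_mP : measurable_fun setT one by exact: measurable_cst.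
have one01 l : 0 <= one l <= 1 by rewrite /one ler01 lexx.
have one_rad : \int[mu]_l (one l * rad l) = 1.
  by rewrite -Rintegral_rad; apply: eq_Rintegral => l _; rewrite mul1r.
have one_vec k : \int[mu]_l (one l * vec k l) = 0.
  by rewrite -(Rintegral_vec k); apply: eq_Rintegral => l _; rewrite mul1r.
exists _, _, mu, sig, p; split; [|split; [|split; [|split; [|split; [|split; [|split]]]]]].
- by move=> l; apply: psd_qubit_op; [exact: rad_ge0|exact: sum_vec_sqr].
- move=> i j; split.
  + have [+ _] := integral_response (complex.Re ((1%:M : 'M[complex R]_2) i j))
      (fun k => complex.Re (pauli R k i j)) one_mP one01.
    by apply: eq_integrable => // l _; rewrite mul1r Re_qubit_op.
  + have [+ _] := integral_response (complex.Im ((1%:M : 'M[complex R]_2) i j))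
      (fun k => complex.Im (pauli R k i j)) one_mP one01.
    by apply: eq_integrable => // l _; rewrite mul1r Im_qubit_op.
- by rewrite -integral_rad; apply: eq_integral => l _; rewrite trace_qubit_op.
- by move=> x x1 o l; case/andP: (p01 x o l x1).
- by move=> x x1 l; rewrite /p addrC subrK.
- by move=> x x1 o; exact: mp.
- move=> x x1 o i j; rewrite assemblage_canon Re_qubit_op Im_qubit_op; split.
  + have [_] := integral_response (complex.Re ((1%:M : 'M[complex R]_2) i j))
      (fun k => complex.Re (pauli R k i j)) (mp x o x1) (fun l => p01 x o l x1).
    rewrite p_rad//; under [X in 2^-1 * (_ + X)]eq_bigr do rewrite p_vec//.
    by move=> <-; apply: eq_integral => l _; rewrite Re_qubit_op.
  + have [_] := integral_response (complex.Im ((1%:M : 'M[complex R]_2) i j))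
      (fun k => complex.Im (pauli R k i j)) (mp x o x1) (fun l => p01 x o l x1).
    rewrite p_rad//; under [X in 2^-1 * (_ + X)]eq_bigr do rewrite p_vec//.
    by move=> <-; apply: eq_integral => l _; rewrite Im_qubit_op.
- move=> i j; rewrite ptrA_canon Re_qubit_op Im_qubit_op; split.
  + have [_] := integral_response (complex.Re ((1%:M : 'M[complex R]_2) i j))
      (fun k => complex.Re (pauli R k i j)) one_mP one01.
    rewrite one_rad; under [X in 2^-1 * (_ + X)]eq_bigr do rewrite one_vec.
    by move=> <-; apply: eq_integral => l _; rewrite mul1r Re_qubit_op.
  + have [_] := integral_response (complex.Im ((1%:M : 'M[complex R]_2) i j))
      (fun k => complex.Im (pauli R k i j)) one_mP one01.
    rewrite one_rad; under [X in 2^-1 * (_ + X)]eq_bigr do rewrite one_vec.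
    by move=> <-; apply: eq_integral => l _; rewrite mul1r Im_qubit_op.
Qed.

End Model.

Unset Implicit Arguments.

Theorem theorem1 (R : realType) (rho0 : 'M[complex R]_4) (a T : 'I_3 -> R) :
  is_state rho0 ->
  ptrA rho0 \in unitmx ->
  canonical_form_of rho0 (canon_state a T) ->
  (forall x : 'I_3 -> R, unit3 x ->
     dot3 a x ^+ 2 + 2 * Num.sqrt (\sum_(k < 3) (T k * x k) ^+ 2) <= 1) ->
  unsteerable_AB_proj (canon_state a T).
Proof. by move=> _ _ _; exact: unsteerable_canon. Qed.
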